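(* Let $\ell\ge1$. The elements $\sigma_i\in SO_{2\ell+1}$ defined by $$\sigma_1=z\,S^B_1,\qquad \sigma_k=S^B_k,\quad 1<k\le\ell,$$ where $z=-\mathrm{Id}_{2\ell+1}$, generate a group isomorphic to the Weyl group $W(B_\ell)$.
   Context: $O_{2\ell+1}=\{g\in GL_{2\ell+1}(\mathbb C): \mathcal S(g^\tau)^{-1}\mathcal S^{-1}=g\}$, where $(g^\tau)_{ij}=g_{2\ell+2-j,\,2\ell+2-i}$ and $\mathcal S=\mathrm{diag}(1,-1,\dots,-1,1)$; $SO_{2\ell+1}$ is its subgroup of elements of determinant $1$. Let $T_i$ be the diagonal $(2\ell+1)\times(2\ell+1)$ matrix with $-1$ at place $i$ and $1$ elsewhere, $S_i$ the permutation matrix of the transposition $(i\;i+1)$, $\overline S_i=T_iS_iT_i^{-1}$. Then $S_1^B=S_{\ell+1}S_\ell S_{\ell+1}$ and $S^B_k=S_{\ell+1-k}\overline S_{\ell+k}$ for $1<k\le\ell$; these are elements of $O_{2\ell+1}$. *)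

(* Defs.v *)
From mathcomp Require Import all_boot all_order all_algebra.
From mathcomp Require Import complex.
From mathcomp Require Import boolp classical_sets functions reals.

Set Implicit Arguments.
Unset Strict Implicit.
Unset Printing Implicit Defensive.

Import Order.TTheory GRing.Theory Num.Theory.
Local Open Scope classical_set_scope.
Local Open Scope ring_scope.

(* Subgroups of GL_n(F) are represented as sets of n x n matrices. *)
Definition is_matrix_group (F : fieldType) (n : nat) (G : set 'M[F]_n) : Prop :=
  [/\ forall A, G A -> A \in unitmx,
      G 1%:M,
      forall A B, G A -> G B -> G (A *m B)
    & forall A, G A -> G (invmx A)].

(* Meaningful when X consists of invertible matrices; otherwise the
   intersection is over the empty family. *)
Definition generated_group (F : fieldType) (n : nat) (X : set 'M[F]_n) :
  set 'M[F]_n := smallest (@is_matrix_group F n) X.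

Definition isomorphic_groups (F F' : fieldType) (m n : nat)
    (G : set 'M[F]_m) (H : set 'M[F']_n) : Prop :=
  exists f : 'M[F]_m -> 'M[F']_n,
    set_bij G H f /\
    (forall A B, G A -> G B -> f (A *m B) = f A *m f B).

(* The complex numbers are R[i] and matrices have size 2l+1 = l.*2.+1.  The
   matrix places 1, ..., 2l+1 of the mathematics are the ordinals
   0, ..., 2l, so i |-> 2l+2-i is rev_ord. *)

Definition antitranspose (F : fieldType) (n : nat) (g : 'M[F]_n) : 'M[F]_n :=
  \matrix_(i, j) g (rev_ord j) (rev_ord i).

(* diag(1, -1, 1, ..., -1, 1), with alternating signs *)
Definition form_mx (F : fieldType) (n : nat) : 'M[F]_n :=
  diag_mx (\row_(i < n) (-1) ^+ i).

Definition orthogonal_group (R : realType) (l : nat) : set 'M[R[i]]_(l.*2.+1) :=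
  [set g | g \in unitmx /\
     form_mx _ _ *m invmx (antitranspose g) *m invmx (form_mx _ _) = g].

Definition special_orthogonal_group (R : realType) (l : nat) :
  set 'M[R[i]]_(l.*2.+1) := [set g | orthogonal_group g /\ \det g = 1].

(* The place numbered i, for 1 <= i <= n.+1, in 1-based numbering. *)
Definition place (n i : nat) : 'I_n.+1 := inord i.-1.

Definition Tmx (F : fieldType) (n i : nat) : 'M[F]_n.+1 :=
  diag_mx (\row_j (if j == place n i then -1 else 1)).

Definition Smx (F : fieldType) (n i : nat) : 'M[F]_n.+1 :=
  tperm_mx (place n i) (place n i.+1).

Definition Sbarmx (F : fieldType) (n i : nat) : 'M[F]_n.+1 :=
  Tmx F n i *m Smx F n i *m invmx (Tmx F n i).

Definition SBmx (R : realType) (l k : nat) : 'M[R[i]]_(l.*2.+1) :=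
  if k == 1%N then Smx _ _ (l + 1) *m Smx _ _ l *m Smx _ _ (l + 1)
  else Smx _ _ (l + 1 - k) *m Sbarmx _ _ (l + k).

Definition sigma (R : realType) (l k : nat) : 'M[R[i]]_(l.*2.+1) :=
  if k == 1%N then (- 1%:M) *m SBmx R l 1 else SBmx R l k.

Definition dotp (R : realType) (l : nat) (u v : 'rV[R]_l) : R :=
  \sum_(i < l) u 0 i * v 0 i.

(* Matrix, for the right action on row vectors, of the orthogonal reflection
   in the hyperplane a^\perp. *)
Definition reflection_mx (R : realType) (l : nat) (a : 'rV[R]_l) : 'M[R]_l :=
  lin1_mx (fun v : 'rV[R]_l => v - (2 * dotp v a / dotp a a) *: a).

Definition weyl_group (R : realType) (l : nat) (Phi : set 'rV[R]_l) :
  set 'M[R]_l := generated_group [set reflection_mx a | a in Phi].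

(* The root system B_l in R^l: all +-e_i, and all +-e_i +- e_j with i != j. *)
Definition root_system_B (R : realType) (l : nat) : set 'rV[R]_l :=
  [set a | (exists (i : 'I_l) (s : bool), a = (-1) ^+ s *: delta_mx 0 i) \/
           (exists (i j : 'I_l) (s t : bool), i != j /\
              a = (-1) ^+ s *: delta_mx 0 i + (-1) ^+ t *: delta_mx 0 j)].

(* Main.v *)
(* The signed permutation matrices A of size l form W(B_l).  Let P(A) be the
   permutation of the 2l vectors +-e_i induced by A, with one more fixed vector
   put in the middle, and let chi(A) be the product of the signs of A, which is
   det A times the determinant of the entrywise square of A.  In a suitable
   signed basis, A |-> chi(A) P(A) maps the simple reflections of B_l to the
   sigma_k, so it maps W(B_l) onto the group they generate.  It is injective
   because chi(A) is the middle entry of the image and A is the action of P(A)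
   on the differences [e_i] - [-e_i].  The images are real orthogonal matrices
   commuting with diag(1, -1, ..., 1) times the order-reversing permutation,
   which is the condition defining O_{2l+1}. *)

From mathcomp Require Import fingroup perm.
Require Import Defs.
From mathcomp Require Import all_boot all_order all_algebra.
From mathcomp Require Import complex.
From mathcomp Require Import boolp classical_sets functions reals.
From mathcomp Require Import ring zify.

Set Implicit Arguments.
Unset Strict Implicit.
Unset Printing Implicit Defensive.

Import Order.TTheory GRing.Theory Num.Theory.
Local Open Scope classical_set_scope.
Local Open Scope ring_scope.

(** * Generated matrix groups and their images under multiplicative maps *)

Lemma invmx_unique (F : fieldType) (n : nat) (A B : 'M[F]_n) :
  A *m B = 1%:M -> invmx A = B.
Proof.
move=> AB1; have [uA _] := mulmx1_unit AB1.
by rewrite -[B](mulKmx uA) AB1 mulmx1.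
Qed.

Lemma unitmx_group (F : fieldType) (n : nat) :
  is_matrix_group [set A : 'M[F]_n | A \in unitmx].
Proof.
split=> //= [|A B uA uB|A]; first exact: unitmx1.
  by rewrite unitmx_mul uA.
by rewrite unitmx_inv.
Qed.

(** An intersection of matrix groups is a matrix group as soon as the family is nonempty; the
    hypothesis puts the group of all invertible matrices into it. *)
Lemma generated_group_group (F : fieldType) (n : nat) (X : set 'M[F]_n) :
  X `<=` [set A | A \in unitmx] -> is_matrix_group (generated_group X).
Proof.
move=> Xu; split=> [A gA|G [[]]//|A B gA gB G GX|A gA G GX].
- exact: (gA _ (conj (unitmx_group F n) Xu)).
- by have [[_ _ M _] _] := GX; apply: M; [apply: gA|apply: gB].
- by have [[_ _ _ I] _] := GX; apply: I; apply: gA.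
Qed.

Section Morphism.
Variables (F F' : fieldType) (m n : nat) (K : set 'M[F]_m).
Variables (h : 'M[F]_m -> 'M[F']_n).
Hypotheses (Kgrp : is_matrix_group K) (h1 : h 1%:M = 1%:M).
Hypothesis (hM : forall A B, K A -> K B -> h (A *m B) = h A *m h B).

Lemma morph_invmx A : K A -> h A *m h (invmx A) = 1%:M.
Proof.
have [Ku _ _ KV] := Kgrp => KA.
by rewrite -hM ?mulmxV ?h1 //; [apply: Ku|apply: KV].
Qed.

(** One inclusion holds because the image of the generated group is a matrix group containing [h @]
    X[. For the other, the elements of]K[that]h[sends into]generated_group (h @[X)] form a matrix
    group containing [X]. *)
Lemma morph_generated_group X : X `<=` K ->
  generated_group (h @` X) = h @` generated_group X.
Proof.
move=> XK; have [Ku K1 KM KV] := Kgrp.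
have Xu : X `<=` [set A | A \in unitmx] by move=> A /XK /Ku.
have [gu g1 gM gV] := generated_group_group Xu.
have gK : generated_group X `<=` K by apply: smallest_sub.
have hXu : h @` X `<=` [set A | A \in unitmx].
  by move=> _ [A /XK KA <-] /=; have [] := mulmx1_unit (morph_invmx KA).
have [hu hg1 hgM hgV] := generated_group_group hXu.
apply/seteqP; split.
  apply: smallest_sub => [|_ [A XA <-]]; last first.
    by exists A => //; apply: sub_gen_smallest.
  split=> [_ [A /gK KA <-]||_ _ [A gA <-] [B gB <-]|_ [A gA <-]].
  - by have [] := mulmx1_unit (morph_invmx KA).
  - by exists 1%:M.
  - by exists (A *m B); [apply: gM|apply: hM; apply: gK].
  - exists (invmx A); first exact: gV.
    exact/esym/invmx_unique/morph_invmx/gK.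
suff: generated_group X `<=` [set A | K A /\ generated_group (h @` X) (h A)].
  by move=> sub _ [A /sub[_ gA] <-].
apply: smallest_sub => [|A XA]; last first.
  by split; [apply: XK|apply: sub_gen_smallest; exists A].
split=> [A [/Ku]//||A B [KA gA] [KB gB]|A [KA gA]] /=.
- by rewrite h1.
- by split; [apply: KM|rewrite hM //; apply: hgM].
- split; first exact: KV.
  by rewrite -(invmx_unique (morph_invmx KA)); apply: hgV.
Qed.

(** The left inverse [f] makes [h] injective on [G] and inherits multiplicativity from [h], so it is
    itself the isomorphism. *)
Lemma isomorphic_morph_image (G : set 'M[F]_m) (f : 'M[F']_n -> 'M[F]_m) :
    is_matrix_group G -> G `<=` K -> (forall A, K A -> f (h A) = A) ->
  isomorphic_groups (h @` G) G.
Proof.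
move=> [_ _ GM _] GK fK; exists f; split; last first.
  move=> _ _ [A GA <-] [B GB <-].
  have [KA KB] := (GK _ GA, GK _ GB).
  by rewrite -hM // !fK //; apply: GK; apply: GM.
split=> [_ [A GA <-]|x y|A GA]; first by rewrite fK //; apply: GK.
  rewrite !inE => -[A GA <-] [B GB <-]; rewrite !fK; [by move->|exact: GK..].
by exists (h A); [exists A|rewrite fK //; apply: GK].
Qed.

End Morphism.

(** * Signed permutation matrices and the product of their signs *)

Section SignedMonomial.
Variables (F : fieldType) (n : nat).
Implicit Types A B : 'M[F]_n.

(** Having at most one nonzero entry per row is stated by vanishing products, so that closure under
    multiplication is a computation with sums and no permutation has to be extracted. Together with
    orthogonality it forces the nonzero entries to be 1 or -1. *)
Definition row_monomial A := forall i j k, j != k -> A i j * A i k = 0.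

Definition signed_monomial : set 'M[F]_n :=
  [set A | [/\ A *m A^T = 1%:M, row_monomial A & row_monomial A^T]].

Definition sqmx A : 'M[F]_n := map_mx (fun x => x ^+ 2) A.

(* A signed permutation matrix is a sign vector times a permutation matrix;
   this is the product of the signs. *)
Definition sign_product A : F := \det A * \det (sqmx A).

Lemma row_monomial_mul A B :
  row_monomial A -> row_monomial B -> row_monomial (A *m B).
Proof.
move=> mA mB i j k jk; rewrite !mxE mulr_suml big1 // => p _.
rewrite mulr_sumr big1 // => q _; rewrite mulrACA.
have [<-|pq] := eqVneq p q; first by rewrite mB ?mulr0.
by rewrite mA ?mul0r.
Qed.

(** When the sum defining an entry of [A *m B] is squared, each cross term contains two distinct
    entries of one row of [A] and vanishes. *)
Lemma sqmx_mul A B : row_monomial A -> sqmx (A *m B) = sqmx A *m sqmx B.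
Proof.
move=> mA; apply/matrixP => i j; rewrite !mxE expr2 mulr_suml.
apply: eq_bigr => p _; rewrite mulr_sumr (bigD1 p) //= big1 ?addr0.
  by rewrite !mxE mulrACA -!expr2.
by move=> q qp; rewrite mulrACA mA ?mul0r // eq_sym.
Qed.

Lemma sqmx_tr A : sqmx A^T = (sqmx A)^T.
Proof. by apply/matrixP => i j; rewrite !mxE. Qed.

Lemma sqmx1 : sqmx 1%:M = 1%:M.
Proof.
by apply/matrixP => i j; rewrite !mxE; case: eqP; rewrite ?expr1n ?expr0n.
Qed.

Lemma row_monomial1 : row_monomial 1%:M.
Proof.
move=> i j k jk; rewrite !mxE; have [->|] := eqVneq i j; last by rewrite mul0r.
by rewrite (negPf jk) mulr0.
Qed.

Lemma signed_monomial_invmx A : signed_monomial A -> invmx A = A^T.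
Proof. by case=> AT _ _; apply: invmx_unique. Qed.

Lemma signed_monomial_group : is_matrix_group signed_monomial.
Proof.
split=> [A [/mulmx1_unit[]]//||A B [AA mA mA'] [BB mB mB']|A SA].
- by split; rewrite ?trmx1 ?mulmx1 //; apply: row_monomial1.
- split; rewrite ?trmx_mul; try exact: row_monomial_mul.
  by rewrite mulmxA -(mulmxA A) BB mulmx1.
- rewrite signed_monomial_invmx //; case: SA => AA mA mA'.
  by split; rewrite ?trmxK //; apply: mulmx1C.
Qed.

Lemma sqmx_orthogonal A : signed_monomial A -> sqmx A *m (sqmx A)^T = 1%:M.
Proof. by case=> AA mA _; rewrite -sqmx_tr -sqmx_mul // AA sqmx1. Qed.

Lemma sign_productM A B : signed_monomial A ->
  sign_product (A *m B) = sign_product A * sign_product B.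
Proof.
by case=> _ mA _; rewrite /sign_product sqmx_mul // !det_mulmx mulrACA.
Qed.

Lemma sign_product1 : sign_product 1%:M = 1.
Proof. by rewrite /sign_product sqmx1 det1 mulr1. Qed.

Lemma sign_product_sqr A :
  signed_monomial A -> sign_product A * sign_product A = 1.
Proof.
move=> SA; rewrite /sign_product mulrACA.
have det2 (B : 'M[F]_n) : B *m B^T = 1%:M -> \det B * \det B = 1.
  by move=> BB; rewrite -{2}det_tr -det_mulmx BB det1.
by rewrite !det2 ?mulr1 ?sqmx_orthogonal //; case: SA.
Qed.

Lemma signed_monomial_perm (s : {perm 'I_n}) : signed_monomial (perm_mx s).
Proof.
have mono (t : {perm 'I_n}) : row_monomial (perm_mx t).
  move=> i j k jk; rewrite !mxE; have [->|] := eqVneq (t i) j.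
    by rewrite (negPf jk) mulr0.
  by rewrite mul0r.
by split; rewrite ?tr_perm_mx // -perm_mxM mulgV perm_mx1.
Qed.

Lemma sqmx_perm (s : {perm 'I_n}) : sqmx (perm_mx s) = perm_mx s.
Proof.
by apply/matrixP => i j; rewrite !mxE; case: eqP; rewrite ?expr1n ?expr0n.
Qed.

Lemma sign_product_perm (s : {perm 'I_n}) : sign_product (perm_mx s) = 1.
Proof. by rewrite /sign_product sqmx_perm det_perm -expr2 sqrr_sign. Qed.

Definition flip_mx (z : 'I_n) : 'M[F]_n :=
  diag_mx (\row_j (-1) ^+ (j == z)).

Lemma flip_mxE z i j : flip_mx z i j = (-1) ^+ (i == z) *+ (i == j).
Proof. by rewrite !mxE; case: eqVneq => // <-. Qed.

Lemma flip_mx_tr z : (flip_mx z)^T = flip_mx z.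
Proof. exact: tr_diag_mx. Qed.

Lemma sqmx_flip z : sqmx (flip_mx z) = 1%:M.
Proof.
apply/matrixP => i j; rewrite mxE flip_mxE mxE.
by case: (i == j); rewrite ?sqrr_sign ?expr0n.
Qed.

Lemma flip_mxK z : flip_mx z *m flip_mx z = 1%:M.
Proof.
apply/matrixP => i j; rewrite mul_diag_mx !mxE.
by case: (i == j); rewrite ?mulr0 // mulr1n -expr2 sqrr_sign.
Qed.

Lemma signed_monomial_flip z : signed_monomial (flip_mx z).
Proof.
have mono : row_monomial (flip_mx z).
  move=> i j k jk; rewrite !flip_mxE; have [->|] := eqVneq i j.
    by rewrite (negPf jk) mulr0n mulr0.
  by rewrite mulr0n mul0r.
by split; rewrite ?flip_mx_tr ?flip_mxK.
Qed.

Lemma sign_product_flip z : sign_product (flip_mx z) = -1.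
Proof.
rewrite /sign_product sqmx_flip det1 mulr1 det_diag (bigD1 z) //= big1 => [|i].
  by rewrite mxE eqxx mulr1.
by rewrite mxE => /negPf->.
Qed.

End SignedMonomial.

(** Induction on the distance: the transposition (i, i+d+1) is the conjugate of (i, i+d) by the
    adjacent transposition (i+d, i+d+1). *)
Lemma tperm_mx_adjacent (F : fieldType) (m : nat) (G : set 'M[F]_m.+1) :
    is_matrix_group G ->
    (forall i, (i < m)%N -> G (tperm_mx (inord i) (inord i.+1))) ->
  forall i j, G (tperm_mx i j).
Proof.
move=> [_ G1 GM _] Gadj.
have G0 d (i : 'I_m.+1) :
    (i + d < m.+1)%N -> G (tperm_mx i (inord (i + d))).
  elim: d => [|d IH] lt_id.
    by rewrite addn0 inord_val /tperm_mx tperm1 perm_mx1.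
  set b : 'I_m.+1 := inord (i + d); set c : 'I_m.+1 := inord (i + d).+1.
  rewrite addnS -/c.
  have bE : b = (i + d)%N :> nat by rewrite inordK //; lia.
  have cE : c = (i + d).+1 :> nat by rewrite inordK //; lia.
  have Gbc : G (tperm_mx b c) by apply: Gadj; lia.
  have bc : b != c by rewrite -val_eqE /= bE cE; lia.
  (* For d = 0 the places [i] and [b] coincide and the conjugation formula fails, but [Gbc] is
     already the claim. *)
  have [d0|d_gt0] := posnP d.
    by have -> : i = b by apply: val_inj; rewrite /= bE d0 addn0.
  rewrite /tperm_mx; have -> : tperm i c = (tperm i b ^ tperm b c)%g.
    rewrite tpermJ tpermL tpermD // -val_eqE /=; lia.
  rewrite /conjg tpermV !perm_mxM.
  by apply: (GM) => //; apply: GM => //; apply: IH; lia.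
have G0' (i j : 'I_m.+1) : (i <= j)%N -> G (tperm_mx i j).
  by move=> ij; rewrite -(inord_val j) -(subnKC ij); apply: G0; rewrite subnKC.
move=> i j; case: (leqP i j) => [/G0'//|/ltnW/G0'].
by rewrite /tperm_mx tpermC.
Qed.

(** * Reflections as explicit matrices *)

Section Reflections.
Variables (R : realType) (n : nat).
Implicit Types (a : 'rV[R]_n) (i j z : 'I_n).

Lemma dotp_mulmx a b : dotp a b = (a *m b^T) 0 0.
Proof. by rewrite mxE; apply: eq_bigr => i _; rewrite mxE. Qed.

Lemma reflection_mxE a :
  reflection_mx a = 1%:M - (2 / dotp a a) *: (a^T *m a).
Proof.
apply/matrixP => i j; rewrite !mxE big_ord1 !mxE /=.
have -> : dotp (delta_mx 0 i) a = a 0 i by rewrite dotp_mulmx -rowE !mxE.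
rewrite (eq_sym j). ring.
Qed.

(** An orthogonal [g] preserves the scalar product, so reflections in all roots of one orbit are
    conjugate to a single one. *)
Lemma reflection_mx_conj a (g : 'M[R]_n) : g *m g^T = 1%:M ->
  reflection_mx (a *m g) = g^T *m reflection_mx a *m g.
Proof.
move=> gg; rewrite !reflection_mxE !dotp_mulmx trmx_mul.
rewrite -mulmxA (mulmxA g) gg mul1mx mulmxBr mulmxBl mulmx1 (mulmx1C gg).
by rewrite -scalemxAr -scalemxAl !mulmxA.
Qed.

Lemma reflection_mxZsign (s : bool) a :
  reflection_mx ((-1) ^+ s *: a) = reflection_mx a.
Proof.
rewrite !reflection_mxE !dotp_mulmx.
have sq p q r (C : 'M[R]_(p, q)) (D : 'M_(q, r)) :
    ((-1) ^+ s *: C) *m ((-1) ^+ s *: D) = C *m D.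
  by rewrite -scalemxAl -scalemxAr scalerA -expr2 sqrr_sign scale1r.
have trZ : ((-1) ^+ s *: a)^T = (-1) ^+ s *: a^T.
  by apply/matrixP => i j; rewrite !mxE.
by rewrite !trZ !sq.
Qed.

Lemma reflection_delta z : reflection_mx (delta_mx 0 z) = flip_mx R z.
Proof.
rewrite reflection_mxE dotp_mulmx -rowE !mxE !eqxx divr1.
apply/matrixP => i j; rewrite flip_mxE !mxE big_ord1 !mxE /=.
rewrite (eq_sym j z) (eq_sym i z).
have [<-|] := eqVneq z i; last by rewrite mul0r mulr0 subr0.
by case: (z == j) => /=; rewrite ?mulr1n ?mulr0n; ring.
Qed.

(** The root has squared length 2, so the coefficient [2 / dotp a a] is 1 and the reflection is the
    identity minus [a^T *m a]. *)
Lemma reflection_deltaB i j : i != j ->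
  reflection_mx (delta_mx 0 i - delta_mx 0 j : 'rV[R]_n) = tperm_mx i j.
Proof.
move=> ij; set a := _ - _.
have aE k : a 0 k = (k == i)%:R - (k == j)%:R by rewrite !mxE.
have -> : reflection_mx a = 1%:M - a^T *m a.
  rewrite reflection_mxE; have -> : dotp a a = 2.
    rewrite /dotp (bigD1 i) //= (bigD1 j) 1?eq_sym //= big1 => [|k /andP[ki kj]].
      by rewrite !aE !eqxx (eq_sym j i) (negPf ij) /=; ring.
    by rewrite aE (negPf ki) (negPf kj) subrr mul0r.
  by rewrite divff ?scale1r // pnatr_eq0.
apply/matrixP => p q; rewrite mxE !mxE big_ord1 !mxE /= -!/(a 0 _).
rewrite [LHS](_ : _ = (p == q)%:R - ((p == i)%:R - (p == j)%:R) *
  ((q == i)%:R - (q == j)%:R)) //.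
rewrite !(eq_sym q).
case: tpermP => [->|->|/eqP/negPf-> /eqP/negPf->].
- by rewrite eqxx (negPf ij); case: (i == q); case: (j == q) => /=; ring.
- rewrite eqxx (eq_sym j i) (negPf ij).
  by case: (i == q); case: (j == q) => /=; ring.
- by rewrite subrr mul0r subr0.
Qed.

End Reflections.

(** * The Weyl group of type B and its simple reflections *)

Section WeylGroupB.
Variables (R : realType) (m : nat).

(** In 1-based notation these are the reflections in the short simple root e_l, for k = 1, and in
    e_{l+1-k} - e_{l+2-k}, for k > 1, with l = m+1. The numbering starts at the short root to match
    that of the [sigma] matrices. *)
Definition simple_mx (k : nat) : 'M[R]_m.+1 :=
  if k == 1%N then flip_mx R ord_max
  else tperm_mx (inord (m.+1 - k)) (inord (m.+2 - k)).

Lemma signed_monomial_simple k : signed_monomial (simple_mx k).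
Proof.
rewrite /simple_mx; case: ifP => _; first exact: signed_monomial_flip.
exact: signed_monomial_perm.
Qed.

(** Adjacent swaps give all transpositions; conjugating the last sign change by these gives every
    sign change, and conjugating transpositions by sign changes gives the reflections in e_i + e_j.
    Conversely every simple reflection is a root reflection. *)
Lemma weyl_group_B_simple : weyl_group (@root_system_B R m.+1) =
  generated_group (simple_mx @` [set k | (1 <= k <= m.+1)%N]).
Proof.
set X := simple_mx @` _; have [Su _ _ _] := signed_monomial_group R m.+1.
have Xu : X `<=` [set A | A \in unitmx].
  by move=> _ [k _ <-] /=; apply/Su/signed_monomial_simple.
have gG := generated_group_group Xu; have [_ _ gM gV] := gG.
have sub : [set reflection_mx a | a in @root_system_B R m.+1] `<=`
    generated_group X.
  have gT i j : generated_group X (tperm_mx i j).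
    apply: (tperm_mx_adjacent gG) => p pm; apply: sub_gen_smallest.
    exists (m.+1 - p)%N; first by rewrite /=; lia.
    have -> : p = (m.+1 - (m.+1 - p))%N by lia.
    rewrite /simple_mx ifF; last by lia.
    by congr (tperm_mx (inord _) (inord _)); lia.
  have gconj g A : g *m g^T = 1%:M -> generated_group X g ->
      generated_group X A -> generated_group X (g^T *m A *m g).
    move=> gg Xg XA; apply: (gM) => //; apply: (gM) => //.
    by rewrite -(invmx_unique gg); apply: gV.
  have gF z : generated_group X (flip_mx R z).
    rewrite -reflection_delta.
    have -> : delta_mx 0 z =
        delta_mx 0 ord_max *m tperm_mx ord_max z :> 'rV[R]_m.+1.
      rewrite -rowE; apply/rowP => j; rewrite !mxE eqxx tpermL /=.
      by rewrite eq_sym.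
    have [TT _ _] := signed_monomial_perm R (tperm (ord_max : 'I_m.+1) z).
    rewrite reflection_mx_conj // reflection_delta; apply: gconj => //.
    by apply: sub_gen_smallest; exists 1%N.
  move=> _ [a [[i [s ->]]|[i [j [s [t [ij ->]]]]]] <-].
    by rewrite reflection_mxZsign reflection_delta.
  (* A global sign does not change the reflection, so only the relative sign of the two terms
     matters. *)
  have -> : (-1) ^+ s *: delta_mx 0 i + (-1) ^+ t *: delta_mx 0 j =
     (-1) ^+ s *: (delta_mx 0 i + (-1) ^+ (s (+) t) *: delta_mx 0 j) :> 'rV[R]_m.+1.
    by rewrite scalerDr scalerA -signr_addb addbA addbb.
  rewrite reflection_mxZsign; case: (s (+) t).
    by rewrite expr1 scaleN1r reflection_deltaB.
  rewrite expr0 scale1r.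
  have -> : delta_mx 0 i + delta_mx 0 j =
      (delta_mx 0 i - delta_mx 0 j) *m flip_mx R j :> 'rV[R]_m.+1.
    apply/rowP => k; rewrite mul_mx_diag !mxE /=.
    have [->|] := eqVneq k j; first by rewrite eq_sym (negPf ij) /= expr1; ring.
    by rewrite expr0 subr0 addr0 mulr1.
  rewrite reflection_mx_conj ?flip_mx_tr ?flip_mxK // reflection_deltaB //.
  by rewrite -{1}flip_mx_tr; apply: gconj; rewrite ?flip_mx_tr ?flip_mxK.
apply/seteqP; split; first exact: smallest_sub.
apply: smallest_sub => [|_ [k /= k_range <-]].
  (* Root reflections are invertible because [sub] places them in the group generated by [X]. *)
  by apply: generated_group_group => A /sub /(let: And4 u _ _ _ := gG in u _).
apply: sub_gen_smallest; rewrite /simple_mx; case: ifP => k1.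
  exists (delta_mx 0 ord_max); last by rewrite reflection_delta.
  by left; exists ord_max, false; rewrite expr0 scale1r.
have ab : inord (m.+1 - k) != inord (m.+2 - k) :> 'I_m.+1.
  by rewrite -val_eqE /= !inordK; lia.
exists (delta_mx 0 (inord (m.+1 - k)) - delta_mx 0 (inord (m.+2 - k))).
  by right; eexists _, _, false, true; split; first exact: ab;
    rewrite expr0 expr1 scale1r scaleN1r.
by rewrite reflection_deltaB.
Qed.

End WeylGroupB.

(** * The twisted permutation representation of dimension 2l+1 *)

Section Representation.
Variables (C : numFieldType) (m : nat).
Local Notation l := m.+1.
Local Notation N := l.*2.+1.
Implicit Types (i j : 'I_l) (A B : 'M[C]_l).

(** Places, counted from 0, of the vectors e_i, of the additional fixed vector, and of the vectors
    -e_i. Reversing the order of the places exchanges [low i] and [high i]. *)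
Definition low i : 'I_N := inord i.
Definition mid : 'I_N := inord l.
Definition high i : 'I_N := inord (l.*2 - i).

Lemma lowE i : low i = i :> nat.
Proof. by rewrite inordK //; have := ltn_ord i; lia. Qed.

Lemma midE : mid = l :> nat.
Proof. by rewrite inordK //; lia. Qed.

Lemma highE i : high i = (l.*2 - i)%N :> nat.
Proof. by rewrite inordK //; have := ltn_ord i; lia. Qed.

Lemma low_inj : injective low.
Proof. by move=> i j /(congr1 val) /=; rewrite !lowE => /val_inj. Qed.

Lemma high_inj : injective high.
Proof.
move=> i j /(congr1 val) /=; rewrite !highE => eq_ij; apply: val_inj => /=.
by have := (ltn_ord i, ltn_ord j) => -[]; lia.
Qed.

Lemma low_high i j : (low i == high j) = false.
Proof.
apply/negbTE; rewrite -val_eqE /= lowE highE.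
by have := (ltn_ord i, ltn_ord j) => -[]; lia.
Qed.

Lemma low_mid i : (low i == mid) = false.
Proof. by apply/negbTE; rewrite -val_eqE /= lowE midE; have := ltn_ord i; lia. Qed.

Lemma high_mid i : (high i == mid) = false.
Proof. by apply/negbTE; rewrite -val_eqE /= highE midE; have := ltn_ord i; lia. Qed.

Lemma place_cases (p : 'I_N) :
  [\/ exists i, p = low i, exists i, p = high i | p = mid].
Proof.
case: (ltngtP p l) => [p_lt|p_gt|p_eq]; last by apply/Or33/val_inj; rewrite /= midE.
  by apply: Or31; exists (Ordinal p_lt); apply: val_inj; rewrite /= lowE.
have ip : (l.*2 - p < l)%N by have := ltn_ord p; lia.
apply: Or32; exists (Ordinal ip); apply: val_inj; rewrite /= highE /=.
by have := ltn_ord p; lia.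
Qed.

(* The signs make the high block of sigma_k, for k > 1, an unsigned swap. *)
Definition high_sign i : C := (-1) ^+ (m - i).

Definition lowmx : 'M[C]_(l, N) := rowsub low 1%:M.
Definition highmx : 'M[C]_(l, N) :=
  diag_mx (\row_i high_sign i) *m rowsub high 1%:M.
Definition midmx : 'M[C]_(1, N) := rowsub (fun=> mid) 1%:M.

Lemma low_mulmxE p (X : 'M[C]_(N, p)) i q : (lowmx *m X) i q = X (low i) q.
Proof. by rewrite -rowsubE mxE. Qed.

Lemma high_mulmxE p (X : 'M[C]_(N, p)) i q :
  (highmx *m X) i q = high_sign i * X (high i) q.
Proof. by rewrite -mulmxA -rowsubE mul_diag_mx !mxE. Qed.

Lemma mid_mulmxE p (X : 'M[C]_(N, p)) (i : 'I_1) q : (midmx *m X) i q = X mid q.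
Proof. by rewrite -rowsubE mxE. Qed.

Lemma lowmxE i q : lowmx i q = (low i == q)%:R.
Proof. by rewrite !mxE. Qed.

Lemma highmxE i q : highmx i q = high_sign i * (high i == q)%:R.
Proof. by rewrite /highmx mul_diag_mx !mxE. Qed.

Lemma midmxE (i : 'I_1) q : midmx i q = (mid == q)%:R.
Proof. by rewrite !mxE. Qed.

Lemma high_sign_neq0 i : high_sign i != 0.
Proof. by rewrite signr_eq0. Qed.

Lemma block_mx_ext p (X Y : 'M[C]_(N, p)) :
    lowmx *m X = lowmx *m Y -> highmx *m X = highmx *m Y ->
    midmx *m X = midmx *m Y -> X = Y.
Proof.
move=> eqL eqH eqM; apply/matrixP => r q.
case: (place_cases r) => [[i ->]|[i ->]|->].
- by rewrite -!low_mulmxE eqL.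
- by apply: (mulfI (high_sign_neq0 i)); rewrite -!high_mulmxE eqH.
- by rewrite -!(mid_mulmxE _ ord0) eqM.
Qed.

Lemma low_lowT : lowmx *m lowmx^T = 1%:M.
Proof.
by apply/matrixP => i j; rewrite low_mulmxE mxE lowmxE mxE (inj_eq low_inj) eq_sym.
Qed.

Lemma low_highT : lowmx *m highmx^T = 0.
Proof.
apply/matrixP => i j; rewrite low_mulmxE mxE highmxE mxE eq_sym.
by rewrite low_high mulr0.
Qed.

Lemma high_lowT : highmx *m lowmx^T = 0.
Proof. by apply: trmx_inj; rewrite trmx_mul trmxK low_highT trmx0. Qed.

Lemma high_highT : highmx *m highmx^T = 1%:M.
Proof.
apply/matrixP => i j; rewrite high_mulmxE mxE highmxE mxE.
rewrite (inj_eq high_inj) (eq_sym j).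
have [->|] := eqVneq i j; last by rewrite !mulr0.
by rewrite mulr1 -expr2 sqrr_sign.
Qed.

Lemma low_midT : lowmx *m midmx^T = 0.
Proof.
by apply/matrixP => i j; rewrite low_mulmxE mxE midmxE mxE eq_sym low_mid.
Qed.

Lemma high_midT : highmx *m midmx^T = 0.
Proof.
apply/matrixP => i j; rewrite high_mulmxE mxE midmxE mxE eq_sym.
by rewrite high_mid mulr0.
Qed.

Lemma mid_midT : midmx *m midmx^T = 1%:M.
Proof. by apply/matrixP => i j; rewrite mid_mulmxE mxE midmxE !ord1 mxE eqxx. Qed.

(** The rows stand for the differences and the sums of [e_i] and [-e_i]. All are mutually orthogonal
    of squared length 2, which explains the factor [2^-1] in the representation. *)
Definition oddmx := lowmx - highmx.
Definition evenmx := lowmx + highmx.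

(** As 2 is invertible, the low and high rows are recovered as half the sum and half the difference
    of even and odd rows. Identities about the representation can thus be checked on three blocks
    where it acts simply. *)
Lemma odd_even_ext p (X Y : 'M[C]_(N, p)) :
    oddmx *m X = oddmx *m Y -> evenmx *m X = evenmx *m Y ->
    midmx *m X = midmx *m Y -> X = Y.
Proof.
rewrite !mulmxBl !mulmxDl => eqO eqE; have two : 2 != 0 :> C by rewrite pnatr_eq0.
apply: block_mx_ext; apply: (scalerI two); rewrite !scaler_nat !mulr2n.
  have dbl Z : lowmx *m Z + lowmx *m Z = (lowmx *m Z - highmx *m Z) +
    (lowmx *m Z + highmx *m Z) :> 'M_(_, p) by rewrite addrACA addNr addr0.
  by rewrite !dbl eqO eqE.
have dbl Z : highmx *m Z + highmx *m Z = (lowmx *m Z + highmx *m Z) -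
    (lowmx *m Z - highmx *m Z) :> 'M_(_, p) by rewrite opprB [RHS]addrC addrA subrK.
by rewrite !dbl eqO eqE.
Qed.

Lemma odd_oddT : oddmx *m oddmx^T = 2%:M.
Proof.
rewrite /oddmx linearB /= mulmxBl !mulmxBr.
by rewrite low_lowT low_highT high_lowT high_highT subr0 sub0r opprK -raddfD.
Qed.

Lemma even_evenT : evenmx *m evenmx^T = 2%:M.
Proof.
rewrite /evenmx linearD /= mulmxDl !mulmxDr.
by rewrite low_lowT low_highT high_lowT high_highT addr0 add0r -raddfD.
Qed.

Lemma odd_evenT : oddmx *m evenmx^T = 0.
Proof.
rewrite /oddmx /evenmx linearD /= mulmxBl !mulmxDr.
by rewrite low_lowT low_highT high_lowT high_highT addr0 add0r subrr.
Qed.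

Lemma odd_midT : oddmx *m midmx^T = 0.
Proof. by rewrite mulmxBl low_midT high_midT subr0. Qed.

Lemma even_midT : evenmx *m midmx^T = 0.
Proof. by rewrite mulmxDl low_midT high_midT addr0. Qed.

Lemma even_oddT : evenmx *m oddmx^T = 0.
Proof. by apply: trmx_inj; rewrite trmx_mul trmxK odd_evenT trmx0. Qed.

Lemma mid_oddT : midmx *m oddmx^T = 0.
Proof. by apply: trmx_inj; rewrite trmx_mul trmxK odd_midT trmx0. Qed.

Lemma mid_evenT : midmx *m evenmx^T = 0.
Proof. by apply: trmx_inj; rewrite trmx_mul trmxK even_midT trmx0. Qed.

(* A signed permutation matrix A permutes the vectors +-e_1, ..., +-e_l; this
   permutation representation of dimension 2l is the sum of A, acting on the
   differences [e_i] - [-e_i], and of the unsigned permutation matrix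
   sqmx A, acting on the sums.  An additional fixed vector is put at the middle
   place and the whole is twisted by the character sign_product. *)
Definition hyperoctahedral_rep A : 'M[C]_N := sign_product A *:
  (2^-1 *: (oddmx^T *m A *m oddmx + evenmx^T *m sqmx A *m evenmx)
   + midmx^T *m midmx).

(** Orthogonality kills the even and middle summands, and the 2 from [odd_oddT] cancels [2^-1]. *)
Lemma odd_rep A :
  oddmx *m hyperoctahedral_rep A = sign_product A *: (A *m oddmx).
Proof.
rewrite -scalemxAr mulmxDr -scalemxAr mulmxDr !mulmxA odd_oddT odd_evenT odd_midT.
rewrite !mul0mx !addr0 mul_scalar_mx -scalemxAl [2^-1 *: _]scalerA.
by rewrite mulVf ?pnatr_eq0 // scale1r.
Qed.

Lemma even_rep A :
  evenmx *m hyperoctahedral_rep A = sign_product A *: (sqmx A *m evenmx).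
Proof.
rewrite -scalemxAr mulmxDr -scalemxAr mulmxDr !mulmxA even_oddT even_evenT.
rewrite even_midT !mul0mx addr0 add0r mul_scalar_mx -scalemxAl [2^-1 *: _]scalerA.
by rewrite mulVf ?pnatr_eq0 // scale1r.
Qed.

Lemma mid_rep A : midmx *m hyperoctahedral_rep A = sign_product A *: midmx.
Proof.
rewrite -scalemxAr mulmxDr -scalemxAr mulmxDr !mulmxA mid_oddT mid_evenT.
by rewrite mid_midT !mul0mx addr0 scaler0 add0r mul1mx.
Qed.

Lemma hyperoctahedral_rep1 : hyperoctahedral_rep 1%:M = 1%:M.
Proof.
apply: odd_even_ext.
- by rewrite odd_rep sign_product1 scale1r mul1mx mulmx1.
- by rewrite even_rep sign_product1 scale1r sqmx1 mul1mx mulmx1.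
- by rewrite mid_rep sign_product1 scale1r mulmx1.
Qed.

(** On the three blocks the action is by [A], by [sqmx A] and trivially, each times
    [sign_product A]; all these factors are multiplicative. *)
Lemma hyperoctahedral_repM A B : signed_monomial A ->
  hyperoctahedral_rep (A *m B) = hyperoctahedral_rep A *m hyperoctahedral_rep B.
Proof.
move=> SA; have mA : row_monomial A by case: SA.
have sM := sign_productM B SA.
apply: odd_even_ext; rewrite mulmxA.
- rewrite !odd_rep -scalemxAl -(mulmxA A oddmx) odd_rep.
  by rewrite -scalemxAr scalerA mulmxA sM.
- rewrite !even_rep -scalemxAl -(mulmxA _ evenmx) even_rep.
  by rewrite -scalemxAr scalerA mulmxA sM sqmx_mul.
- by rewrite !mid_rep -scalemxAl mid_rep scalerA sM.
Qed.

Lemma hyperoctahedral_rep_tr A :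
  (hyperoctahedral_rep A)^T = hyperoctahedral_rep A^T.
Proof.
have sT : sign_product A^T = sign_product A.
  by rewrite /sign_product sqmx_tr !det_tr.
rewrite /hyperoctahedral_rep sT sqmx_tr.
rewrite linearZ /= [X in _ *: X]linearD /= linearZ /=.
by rewrite [X in _ *: (_ *: X + _)]linearD /= !trmx_mul !trmxK !mulmxA.
Qed.

Definition rep_sign (g : 'M[C]_N) : C := (midmx *m g *m midmx^T) 0 0.

Definition rep_inv (g : 'M[C]_N) : 'M[C]_l :=
  (rep_sign g / 2) *: (oddmx *m g *m oddmx^T).

(** The middle entry is [sign_product A] and the odd block gives twice [sign_product A *: A]; the
    sign squares to 1. *)
Lemma hyperoctahedral_repK A : signed_monomial A ->
  rep_inv (hyperoctahedral_rep A) = A.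
Proof.
move=> SA; rewrite /rep_inv /rep_sign mid_rep odd_rep -!scalemxAl mid_midT.
rewrite -mulmxA odd_oddT mul_mx_scalar !mxE mulr1 !scalerA.
by rewrite -mulrA mulrACA sign_product_sqr // mul1r mulVf ?pnatr_eq0 // scale1r.
Qed.

Lemma low_rep A : lowmx *m hyperoctahedral_rep A =
  (sign_product A / 2) *: (A *m oddmx + sqmx A *m evenmx).
Proof.
have two : 2 != 0 :> C by rewrite pnatr_eq0.
apply: (scalerI two); rewrite scalerA mulrCA divff // mulr1 scalerDr.
rewrite -odd_rep -even_rep -mulmxDl /oddmx /evenmx addrACA addNr addr0.
by rewrite scaler_nat mulr2n mulmxDl.
Qed.

Lemma high_rep A : highmx *m hyperoctahedral_rep A =
  (sign_product A / 2) *: (sqmx A *m evenmx - A *m oddmx).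
Proof.
have two : 2 != 0 :> C by rewrite pnatr_eq0.
apply: (scalerI two); rewrite scalerA mulrCA divff // mulr1 scalerBr.
rewrite -odd_rep -even_rep -mulmxBl /oddmx /evenmx opprB.
by rewrite [X in _ = X *m _]addrC addrA subrK scaler_nat mulr2n mulmxDl.
Qed.

(** A permutation matrix has sign product 1 and equals its entrywise square, so odd and even blocks
    carry the same action and the low and high blocks are simply permuted. *)
Lemma rep_permP (s : {perm 'I_l}) (X : 'M[C]_N) :
    lowmx *m X = perm_mx s *m lowmx -> highmx *m X = perm_mx s *m highmx ->
    midmx *m X = midmx ->
  hyperoctahedral_rep (perm_mx s) = X.
Proof.
move=> XL XH XM; apply: odd_even_ext.
- by rewrite odd_rep sign_product_perm scale1r mulmxBl XL XH mulmxBr.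
- by rewrite even_rep sqmx_perm sign_product_perm scale1r mulmxDl XL XH mulmxDr.
- by rewrite mid_rep sign_product_perm scale1r XM.
Qed.

End Representation.

Lemma placeE n i : (i.-1 <= n)%N -> place n i = i.-1 :> nat.
Proof. exact: inordK. Qed.

(** * The orthogonality condition as commutation with [J] *)

Section SpecialOrthogonal.
Variables (C : numFieldType) (m : nat).
Local Notation l := m.+1.
Local Notation N := l.*2.+1.

Let K : 'M[C]_N := \matrix_(p, q) (rev_ord p == q)%:R.

Lemma form_mxK (F : fieldType) n : form_mx F n *m form_mx F n = 1%:M.
Proof.
apply/matrixP => i j; rewrite mul_diag_mx !mxE.
by case: (i == j); rewrite ?mulr0 // mulr1n -expr2 sqrr_sign.
Qed.

Lemma rev_mulmxE p (X : 'M[C]_(N, p)) i j : (K *m X) i j = X (rev_ord i) j.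
Proof.
rewrite mxE (bigD1 (rev_ord i)) //= mxE eqxx mul1r big1 ?addr0 // => q qi.
by rewrite mxE eq_sym (negPf qi) mul0r.
Qed.

Lemma revmxK : K *m K = 1%:M.
Proof. by apply/matrixP => i j; rewrite rev_mulmxE !mxE rev_ordK. Qed.

Lemma revmx_tr : K^T = K.
Proof.
by apply/matrixP => i j; rewrite !mxE eq_sym (can2_eq rev_ordK rev_ordK).
Qed.

Lemma antitransposeE (g : 'M[C]_N) : antitranspose g = K *m g^T *m K.
Proof.
apply/matrixP => i j; rewrite -[K *m _ *m K]trmxK trmx_mul revmx_tr.
by rewrite [RHS]mxE rev_mulmxE [RHS]mxE rev_mulmxE !mxE.
Qed.

(** The size is odd, so a place and its reverse have the same parity and carry the same sign. *)
Lemma form_rev_comm : form_mx C N *m K = K *m form_mx C N.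
Proof.
apply/matrixP => i j; rewrite rev_mulmxE mul_diag_mx !mxE.
have [_|_] := eqVneq (rev_ord i) j; last by rewrite mulr0.
rewrite mulr1 mulr1n /= subSS -signr_odd -[RHS]signr_odd.
by congr (_ ^+ (nat_of_bool _)); have := ltn_ord i; lia.
Qed.

Let J := form_mx C N *m K.

Lemma JK : J *m J = 1%:M.
Proof.
rewrite /J {2}form_rev_comm -mulmxA (mulmxA K) revmxK mul1mx.
exact: form_mxK.
Qed.

Lemma high_rev (i : 'I_l) : high i = rev_ord (low i).
Proof. by apply: val_inj; rewrite /= highE lowE subSS. Qed.

Lemma JE i j : J i j = (-1) ^+ i * (rev_ord i == j)%:R.
Proof. by rewrite /J mul_diag_mx !mxE. Qed.

(** The sign of [J] at place i is (-1)^i = (-1)^m (-1)^(m-i); the second factor is [high_sign i],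
    which leaves a sign independent of i. *)
Lemma low_J : lowmx C m *m J = (-1) ^+ m *: highmx C m.
Proof.
apply/matrixP => i j; rewrite low_mulmxE JE mxE highmxE -high_rev mulrA lowE.
congr (_ * _); rewrite -exprD -signr_odd -[RHS]signr_odd.
by congr (_ ^+ (nat_of_bool _)); have := ltn_ord i; lia.
Qed.

Lemma high_J : highmx C m *m J = (-1) ^+ m *: lowmx C m.
Proof.
have -> : lowmx C m = (-1) ^+ m *: (highmx C m *m J).
  by rewrite scalemxAl -low_J -mulmxA JK mulmx1.
by rewrite scalerA -expr2 sqrr_sign scale1r.
Qed.

Lemma mid_J : midmx C m *m J = (-1) ^+ l *: midmx C m.
Proof.
apply/matrixP => i j; rewrite mid_mulmxE JE mxE midmxE midE.
by congr (_ * (_ == _)%:R); apply: val_inj; rewrite /= midE; lia.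
Qed.

(** [J] acts by a scalar on each of the odd, even and middle blocks, and the representation
    preserves these blocks. *)
Lemma rep_J_comm (A : 'M[C]_l) :
  J *m hyperoctahedral_rep A = hyperoctahedral_rep A *m J.
Proof.
have odd_J : oddmx C m *m J = - (-1) ^+ m *: oddmx C m.
  by rewrite mulmxBl low_J high_J -scalerBr scaleNr -scalerN opprB.
have even_J : evenmx C m *m J = (-1) ^+ m *: evenmx C m.
  by rewrite mulmxDl low_J high_J -scalerDr addrC.
apply: odd_even_ext; rewrite (mulmxA _ J) (mulmxA _ _ J).
- rewrite odd_J odd_rep -!scalemxAl odd_rep -(mulmxA A) odd_J -scalemxAr.
  by rewrite !scalerA mulrC.
- rewrite even_J even_rep -!scalemxAl even_rep -(mulmxA (sqmx A)) even_J -scalemxAr.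
  by rewrite !scalerA mulrC.
- by rewrite mid_J mid_rep -!scalemxAl mid_rep mid_J !scalerA mulrC.
Qed.

(** Since g^T g = 1 and the antitranspose is K g^T K, its inverse is K g K. The condition becomes J
    g J = g, which is commutation because J is an involution. *)
Lemma orthogonal_rep (A : 'M[C]_l) :
  signed_monomial A -> let g := hyperoctahedral_rep A in
  g \in unitmx /\ form_mx _ _ *m invmx (antitranspose g) *m invmx (form_mx _ _) = g.
Proof.
move=> SA; set g := hyperoctahedral_rep A.
have gg : g^T *m g = 1%:M.
  have [_ _ _ SV] := signed_monomial_group C l.
  rewrite hyperoctahedral_rep_tr -hyperoctahedral_repM.
    by case: SA => /mulmx1C -> _ _; rewrite hyperoctahedral_rep1.
  by rewrite -signed_monomial_invmx //; apply: SV.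
split; first by have [] := mulmx1_unit gg.
rewrite (invmx_unique (form_mxK C N)).
have -> : invmx (antitranspose g) = K *m g *m K.
  apply: invmx_unique; rewrite antitransposeE -!mulmxA (mulmxA K K) revmxK mul1mx.
  by rewrite (mulmxA g^T) gg mul1mx revmxK.
rewrite !mulmxA -/J rep_J_comm -mulmxA -[K *m _]form_rev_comm -/J.
by rewrite -mulmxA JK mulmx1.
Qed.

(** * The matrices [sigma] as images of the simple reflections *)

Lemma low_tperm (a b i : 'I_l) :
  tperm (low a) (low b) (low i) = low (tperm a b i).
Proof. by rewrite inj_tperm //; apply: low_inj. Qed.

Lemma high_tperm (a b i : 'I_l) :
  tperm (high a) (high b) (high i) = high (tperm a b i).
Proof. by rewrite inj_tperm //; apply: high_inj. Qed.

Lemma perm_mulmxE (F : fieldType) n p (s : {perm 'I_n}) (X : 'M[F]_(n, p)) i j :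
  (perm_mx s *m X) i j = X (s i) j.
Proof. by rewrite -row_permE mxE. Qed.

Lemma flip_mulmxE (F : fieldType) n p z (X : 'M[F]_(n, p)) i j :
  (flip_mx F z *m X) i j = (-1) ^+ (i == z) * X i j.
Proof. by rewrite /flip_mx mul_diag_mx !mxE. Qed.

Lemma oddmxE (i : 'I_l) q :
  oddmx C m i q = (low i == q)%:R - high_sign C i * (high i == q)%:R.
Proof. by rewrite /oddmx mxE lowmxE mxE highmxE. Qed.

Lemma evenmxE (i : 'I_l) q :
  evenmx C m i q = (low i == q)%:R + high_sign C i * (high i == q)%:R.
Proof. by rewrite /evenmx mxE lowmxE highmxE. Qed.

Lemma Tmx_flip (F : fieldType) n k : Tmx F n k = flip_mx F (place n k).
Proof.
by congr diag_mx; apply/rowP => j; rewrite !mxE; case: (j == _).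
Qed.

Lemma SbarmxE (F : fieldType) n k i j :
  Sbarmx F n k i j = (-1) ^+ (i == place n k) *
    (tperm (place n k) (place n k.+1) i == j)%:R * (-1) ^+ (j == place n k).
Proof.
rewrite /Sbarmx Tmx_flip (invmx_unique (flip_mxK F _)) /flip_mx.
by rewrite mul_mx_diag mxE mul_diag_mx !mxE.
Qed.

(** The triple product is the transposition of the two places next to the middle, which is how the
    last sign change permutes the vectors. Its sign product -1 accounts for the factor z. *)
Lemma sigma1_rep :
  (- 1%:M) *m (Smx C l.*2 (l + 1) *m Smx _ _ l *m Smx _ _ (l + 1)) =
  hyperoctahedral_rep (flip_mx C (ord_max : 'I_l)).
Proof.
pose z : 'I_l := ord_max.
have pl : place l.*2 l = low z.
  by apply: ord_inj; rewrite placeE ?lowE /=; lia.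
have pl1 : place l.*2 l.+1 = mid m by [].
have pl2 : place l.*2 l.+2 = high z.
  by apply: ord_inj; rewrite placeE ?highE /=; lia.
have -> : (- 1%:M) *m (Smx C _ (l + 1) *m Smx _ _ l *m Smx _ _ (l + 1)) =
    - tperm_mx (low z) (high z).
  rewrite mulNmx mul1mx addn1 /Smx pl pl1 pl2; congr (- _).
  rewrite /tperm_mx -!perm_mxM; congr perm_mx.
  have -> : tperm (low z) (high z) =
      (tperm (low z) (mid m) ^ tperm (mid m) (high z))%g.
    by rewrite tpermJ tpermL tpermD // eq_sym ?low_mid ?low_high // eq_sym low_high.
  by rewrite /conjg tpermV mulgA.
have z_sign : high_sign C z = 1 by rewrite /high_sign /= subnn.
have DE (X Y : 'M[C]_(l, N)) i j : (X + Y) i j = X i j + Y i j by rewrite mxE.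
have NE (X : 'M[C]_(l, N)) i j : (- X) i j = - X i j by rewrite mxE.
have XE p q : (- tperm_mx (low z) (high z) : 'M[C]_N) p q =
    - (tperm (low z) (high z) p == q)%:R by rewrite !mxE.
apply: block_mx_ext; apply/matrixP => i q.
- rewrite low_rep low_mulmxE sign_product_flip sqmx_flip mul1mx XE.
  rewrite mxE DE ?NE flip_mulmxE oddmxE evenmxE -/z.
  have [->|iz] := eqVneq i z.
    by rewrite tpermL expr1 z_sign; field.
  rewrite expr0 tpermD; first by field.
    by rewrite (inj_eq (@low_inj m)) eq_sym.
  by rewrite eq_sym low_high.
- rewrite high_rep high_mulmxE sign_product_flip sqmx_flip mul1mx XE.
  rewrite mxE DE ?NE flip_mulmxE oddmxE evenmxE -/z.
  have [->|iz] := eqVneq i z.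
    by rewrite tpermR expr1 z_sign; field.
  rewrite expr0 tpermD; first by field.
    by rewrite low_high.
  by rewrite (inj_eq (@high_inj m)) eq_sym.
- rewrite mid_rep mid_mulmxE sign_product_flip !mxE tpermD ?low_mid ?high_mid //.
  by rewrite mulN1r.
Qed.

(** The high block runs backwards: counted from 0, place l+k is l+k-1 = 2l-(l+1-k), hence [high b],
    and the next one is [high a]. *)
Lemma sigma_gt1_places k : (1 < k <= l)%N ->
  exists a b : 'I_l, [/\ a = inord (l - k), b = inord (l.+1 - k), b = a.+1 :> nat &
   [/\ place l.*2 (l + 1 - k) = low a, place l.*2 (l + 1 - k).+1 = low b,
       place l.*2 (l + k) = high b & place l.*2 (l + k).+1 = high a]].
Proof.
move=> k_range; exists (inord (l - k)), (inord (l.+1 - k)); split=> //.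
  by rewrite !inordK; lia.
by split; apply: ord_inj; rewrite ?lowE ?highE placeE ?inordK; lia.
Qed.

Lemma sigma_gt1_rep k : (1 < k <= l)%N ->
  Smx C l.*2 (l + 1 - k) *m Sbarmx C l.*2 (l + k) =
  hyperoctahedral_rep (tperm_mx (inord (l - k)) (inord (l.+1 - k))).
Proof.
move=> k_range; have [a [b [<- <- ba [pa pb pb' pa']]]] := sigma_gt1_places k_range.
have ab : a != b by rewrite -val_eqE /= ba; lia.
rewrite /Smx pa pb.
have SE i j : Sbarmx C l.*2 (l + k) i j = (-1) ^+ (i == high b) *
    (tperm (high b) (high a) i == j)%:R * (-1) ^+ (j == high b).
  by rewrite SbarmxE pb' pa'.
apply/esym/rep_permP; apply/matrixP => i q.
- rewrite low_mulmxE !perm_mulmxE SE low_tperm lowmxE.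
  rewrite low_high mul1r tpermD ?[high _ == _]eq_sym ?low_high //.
  by case: eqVneq => [<-|]; rewrite ?mul0r // low_high mulr1.
- rewrite high_mulmxE !perm_mulmxE SE highmxE tpermD ?low_high //.
  rewrite tpermC high_tperm.
  have [<-|_] := eqVneq (high (tperm a b i)) q; last by rewrite !(mulr0, mul0r).
  rewrite !mulr1 !(inj_eq (@high_inj m)) /high_sign mulrA.
  (* The signs at the adjacent indices [a] and [b] are opposite, which cancels the -1 entries of
     [Sbarmx]. *)
  have ma : (m - a = (m - b).+1)%N by have := ltn_ord b; lia.
  case: tpermP => [->|->|_ /eqP/negPf->].
  + by rewrite eqxx (negPf ab) ma exprS expr0 expr1; ring.
  + by rewrite eqxx (negPf ab) ma exprS expr0 expr1; ring.
  + by rewrite !expr0 !mulr1.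
- rewrite mid_mulmxE perm_mulmxE SE midmxE !tpermD ?low_mid ?high_mid //.
  rewrite eq_sym high_mid mul1r; case: eqVneq => [<-|].
    by rewrite eq_sym high_mid mulr1.
  by rewrite mul0r.
Qed.

End SpecialOrthogonal.

(** For k = 1 there are three transpositions and a factor -1 in odd dimension; for k > 1 there are
    two transpositions, and conjugation keeps the determinant. *)
Lemma det_sigma (R : realType) (m : nat) k : (1 <= k <= m.+1)%N ->
  \det (sigma R m.+1 k) = 1.
Proof.
move=> k_range.
have detT (n : nat) (a b : 'I_n) : a != b ->
    \det (tperm_mx a b : 'M[R[i]]_n) = -1.
  by move=> ab; rewrite det_perm odd_tperm ab expr1.
have detS i : (0 < i <= m.+1.*2)%N -> \det (Smx R[i] m.+1.*2 i) = -1.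
  by move=> i_range; apply: detT; rewrite -(inj_eq (@ord_inj _)) !placeE; lia.
rewrite /sigma /SBmx; have [k1|k_neq1] := eqVneq k 1%N.
  rewrite /= !det_mulmx !detS; try lia.
  rewrite -scaleN1r detZ det1 mulr1 -signr_odd /= odd_double expr1.
  by ring.
have [Tu _] := mulmx1_unit (flip_mxK R[i] (place m.+1.*2 (m.+1 + k))).
rewrite /Sbarmx Tmx_flip !det_mulmx !detS; try lia.
move: Tu; rewrite unitmxE unitfE det_inv => Tu.
by field.
Qed.

(** * From real to complex matrices, and the isomorphism *)

Section RealRepresentation.
Variables (R : realType) (m : nat).

Definition complexify (A : 'M[R]_m.+1) : 'M[R[i]]_m.+1 :=
  map_mx (real_complex R) A.

Lemma signed_monomial_complexify A :
  signed_monomial A -> signed_monomial (complexify A).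
Proof.
have mono B : row_monomial B -> row_monomial (complexify B).
  by move=> mB i j k jk; rewrite !mxE -rmorphM mB ?rmorph0.
case=> AA mA mA'; split; rewrite /complexify ?map_trmx; try exact: mono.
by rewrite -map_mxM AA map_mx1.
Qed.

Definition real_rep (A : 'M[R]_m.+1) := hyperoctahedral_rep (complexify A).

Lemma real_rep1 : real_rep 1%:M = 1%:M.
Proof. by rewrite /real_rep /complexify map_mx1 hyperoctahedral_rep1. Qed.

Lemma real_repM A B : signed_monomial A -> signed_monomial B ->
  real_rep (A *m B) = real_rep A *m real_rep B.
Proof.
move=> SA _; rewrite /real_rep /complexify map_mxM hyperoctahedral_repM //.
exact: signed_monomial_complexify.
Qed.

(** On the image of [real_rep] the matrix [rep_inv g] has real entries, so taking real parts loses
    nothing there. *)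
Definition real_rep_inv (g : 'M[R[i]]_(m.+1.*2.+1)) : 'M[R]_m.+1 :=
  map_mx (@complex.Re R) (rep_inv g).

Lemma real_repK A : signed_monomial A -> real_rep_inv (real_rep A) = A.
Proof.
move=> SA; rewrite /real_rep_inv hyperoctahedral_repK.
  by apply/matrixP => i j; rewrite !mxE.
exact: signed_monomial_complexify.
Qed.

Lemma sigma_rep k : (1 <= k <= m.+1)%N ->
  sigma R m.+1 k = real_rep (simple_mx R m k).
Proof.
move=> k_range; rewrite /sigma /SBmx /real_rep /complexify /simple_mx.
have [k1|k_neq1] := eqVneq k 1%N.
  rewrite /= sigma1_rep; congr hyperoctahedral_rep.
  by apply/matrixP => i j; rewrite [RHS]mxE !flip_mxE rmorphMn rmorph_sign.
by rewrite sigma_gt1_rep ?map_tperm_mx //; lia.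
Qed.

End RealRepresentation.

Theorem lemma8p1 (R : realType) (l : nat) (hl : (1 <= l)%N) :
  (forall k : nat, (1 <= k <= l)%N -> special_orthogonal_group (sigma R l k)) /\
  isomorphic_groups
    (generated_group [set sigma R l k | k in [set k : nat | (1 <= k <= l)%N]])
    (weyl_group (@root_system_B R l)).
Proof.
case: l hl => // m _; split=> [k k_range|].
  split; last exact: det_sigma.
  rewrite sigma_rep //.
  exact/orthogonal_rep/signed_monomial_complexify/signed_monomial_simple.
have Sgrp := signed_monomial_group R m.+1.
set X := @simple_mx R m @` [set k | (1 <= k <= m.+1)%N].
have XS : X `<=` @signed_monomial R m.+1.
  by move=> _ [k _ <-]; apply: signed_monomial_simple.
(* The generators are rewritten as images of simple reflections, so that generation commutes with
   [real_rep]. *)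
have -> : [set sigma R m.+1 k | k in [set k : nat | (1 <= k <= m.+1)%N]] =
    @real_rep R m @` X.
  apply/seteqP; split=> [_ [k k_range <-]|_ [_ [k k_range <-] <-]].
    by exists (simple_mx R m k); [exists k|rewrite sigma_rep].
  by exists k => //; rewrite sigma_rep.
rewrite weyl_group_B_simple -/X.
rewrite (morph_generated_group Sgrp (@real_rep1 R m) (@real_repM R m) XS).
apply: (isomorphic_morph_image (@real_repM R m) _ _ (@real_repK R m)).
  by apply: generated_group_group => A /XS; case: Sgrp => u _ _ _ /u.
exact: smallest_sub.
Qed.
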